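(* Let $n\ge 2$ and let $X=(X_{ij})$ be an $n\times n$ adjacency matrix (binary, symmetric, zero diagonal), with $X_{i+}=\sum_{k=1}^n X_{ik}$ and $X_{++}=\sum_{i=1}^n X_{i+}$, and let $\varepsilon_0$ be a real number such that $1\le X_{i+}^2\le\varepsilon_0 X_{++}$ for all $i$. Let $\varepsilon=\{\varepsilon_{ij}:i\ne j\}$ be a family of smooth functions satisfying the sub-exponential assumption with constant $C_0$ (see context), and let $p_{ij}(\alpha)$, $\alpha\in\mathbb{R}^n$, be given by $\log p_{ij}(\alpha)=\alpha_i+\alpha_j+\varepsilon_{ij}(\alpha_i,\alpha_j)$. Put $\tilde\alpha_i=\log X_{i+}-\log\sqrt{X_{++}}$, $\tilde p_{ij}=X_{i+}X_{j+}/X_{++}$, $\bar\varepsilon_0=\{15(C_0+1)\}^{-2}$ and $C=10(C_0+1)$. Suppose $\varepsilon_0\le\bar\varepsilon_0$, let $\hat\alpha$ be a solution to the likelihood equation $\nabla\ell(\hat\alpha)=0$ with $\|\hat\alpha-\tilde\alpha\|_\infty\le C\varepsilon_0$, and let $\hat p_{ij}=p_{ij}(\hat\alpha)$. Then for all $i\ne j$, $$\left|\frac{\hat p_{ij}-\tilde p_{ij}}{\tilde p_{ij}}\right|\le C_1\,\varepsilon_0,\qquad C_1=24(C_0+1).$$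
   Context: The matrix $X$ is deterministic here. For each pair $i\neq j$, $\varepsilon_{ij}:\mathbb{R}^2\to\mathbb{R}$ is smooth, with $\varepsilon_{ij}(x,y)=\varepsilon_{ji}(y,x)$; it is evaluated at $(\alpha_i,\alpha_j)$. Sub-exponential assumption with constant $C_0\ge 0$: for all pairs $i\ne j$ and all indices $k,l,m$, the functions $\varepsilon_{ij}$, $\partial\varepsilon_{ij}/\partial\alpha_k$, $\partial^2\varepsilon_{ij}/(\partial\alpha_k\partial\alpha_l)$ and $\partial^3\varepsilon_{ij}/(\partial\alpha_k\partial\alpha_l\partial\alpha_m)$ are bounded in absolute value by $C_0\exp(\alpha_i+\alpha_j)$. The log-likelihood of the model with independent Bernoulli edges of probabilities $p_{ij}(\alpha)$, defined where all $p_{ij}(\alpha)<1$, is $$\ell(\alpha)=\sum_{i<j}\bigl[X_{ij}\log p_{ij}(\alpha)+(1-X_{ij})\log(1-p_{ij}(\alpha))\bigr],$$ and the likelihood equation is $\nabla\ell(\alpha)=0$. $\|\cdot\|_\infty$ is the maximum norm on $\mathbb{R}^n$. Under the stated hypotheses, a solution $\hat\alpha$ of the likelihood equation with $\|\hat\alpha-\tilde\alpha\|_\infty\le C\varepsilon_0$ is known to exist; $\hat\alpha$ denotes such a solution. *)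

(* Defs.v *)
From mathcomp Require Import all_boot all_order all_algebra.
From mathcomp Require Import all_classical all_reals all_analysis.

Set Implicit Arguments.
Unset Strict Implicit.
Unset Printing Implicit Defensive.

Import Order.TTheory GRing.Theory Num.Theory.
Import numFieldNormedType.Exports.

Local Open Scope ring_scope.
Local Open Scope classical_set_scope.

(* A vector of R^n is a row vector
   a : 'rV[R]_n with coordinates a 0 i; the library norm `|a| on 'rV[R]_n is
   the maximum norm. *)

Definition partial (R : realType) (n : nat) (k : 'I_n) (f : 'rV[R]_n -> R) :
  'rV[R]_n -> R := 'D_(delta_mx 0 k) f.

Definition gradient (R : realType) (n : nat) (f : 'rV[R]_n -> R)
  (a : 'rV[R]_n) : 'rV[R]_n := \row_k partial k f a.

(* The derivability clauses are needed because 'D_v f is a total operator,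
   with an unspecified value where f is not derivable along v. *)
Fixpoint Ck2 (R : realType) (k : nat) (f : R * R -> R) : Prop :=
  match k with
  | 0 => continuous f
  | k'.+1 =>
      [/\ continuous f,
          forall x, derivable f x (1, 0),
          forall x, derivable f x (0, 1),
          Ck2 k' ('D_(1, 0) f)
        & Ck2 k' ('D_(0, 1) f)]
  end.

Definition smooth2 (R : realType) (f : R * R -> R) : Prop :=
  forall k, Ck2 k f.

Definition adjacency (n : nat) (X : 'M[bool]_n) : Prop :=
  (forall i j, X i j = X j i) /\ (forall i, X i i = false).

Definition degree (R : realType) (n : nat) (X : 'M[bool]_n) (i : 'I_n) : R :=
  \sum_(k < n) (X i k)%:R.

Definition total_degree (R : realType) (n : nat) (X : 'M[bool]_n) : R :=
  \sum_(i < n) degree R X i.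

(* The family is indexed by all pairs (i, j); its diagonal members are never
   constrained and never used. *)
Definition eps_family (R : realType) (n : nat) := 'I_n -> 'I_n -> R * R -> R.

Definition eps_at (R : realType) (n : nat) (eps : eps_family R n)
  (i j : 'I_n) (a : 'rV[R]_n) : R := eps i j (a 0 i, a 0 j).

Definition smooth_family (R : realType) (n : nat) (eps : eps_family R n) :
  Prop :=
  forall i j, i != j ->
    smooth2 (eps i j) /\ forall x y, eps i j (x, y) = eps j i (y, x).

Definition sub_exponential (R : realType) (n : nat) (C0 : R)
  (eps : eps_family R n) : Prop :=
  forall i j, i != j -> forall (k l m : 'I_n) (a : 'rV[R]_n),
    let f := eps_at eps i j in
    let B := C0 * expR (a 0 i + a 0 j) in
    [/\ `|f a| <= B,
        `|partial k f a| <= B,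
        `|partial k (partial l f) a| <= B
      & `|partial k (partial l (partial m f)) a| <= B].

Definition edge_prob (R : realType) (n : nat) (eps : eps_family R n)
  (i j : 'I_n) (a : 'rV[R]_n) : R :=
  expR (a 0 i + a 0 j + eps_at eps i j a).

Definition loglik_domain (R : realType) (n : nat) (eps : eps_family R n) :
  set 'rV[R]_n :=
  [set a | forall i j, i != j -> edge_prob eps i j a < 1].

(* Only meaningful on loglik_domain, since ln x = 0 for x <= 0. *)
Definition loglik (R : realType) (n : nat) (X : 'M[bool]_n)
  (eps : eps_family R n) (a : 'rV[R]_n) : R :=
  \sum_(i < n) \sum_(j < n | (i < j)%N)
    ((X i j)%:R * ln (edge_prob eps i j a)
     + (1 - (X i j)%:R) * ln (1 - edge_prob eps i j a)).

(* loglik_domain is open and loglik is derivable along every coordinate there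
   when the family is smooth, so the gradient below is the genuine one. *)
Definition likelihood_solution (R : realType) (n : nat) (X : 'M[bool]_n)
  (eps : eps_family R n) (a : 'rV[R]_n) : Prop :=
  loglik_domain eps a /\ gradient (loglik X eps) a = 0.

Definition alpha_tilde (R : realType) (n : nat) (X : 'M[bool]_n) : 'rV[R]_n :=
  \row_i (ln (degree R X i) - ln (Num.sqrt (total_degree R X))).

Definition p_tilde (R : realType) (n : nat) (X : 'M[bool]_n) (i j : 'I_n) : R :=
  degree R X i * degree R X j / total_degree R X.

(* Main.v *)
Require Import Defs.
From mathcomp Require Import all_boot all_order all_algebra.
From mathcomp Require Import all_classical all_reals all_analysis.
From mathcomp Require Import ring lra.

Import Order.TTheory GRing.Theory Num.Theory.
Import numFieldNormedType.Exports.

Local Open Scope ring_scope.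

(** Write alpha^ and alpha~ for the estimator and its explicit approximation,
    and K = C0 + 1. Since p~_ij = exp (alpha~_i + alpha~_j), the ratio
    p^_ij / p~_ij is exp t with
      t = (alpha^_i - alpha~_i) + (alpha^_j - alpha~_j) + eps_ij (alpha^).
    The first two terms contribute at most 20 K eps0 by hypothesis. For the
    third, the degree condition gives p~_ij <= eps0, because d_i d_j is at most
    the mean of d_i^2 and d_j^2; the sub-exponential bound is then
    C0 exp (alpha^_i + alpha^_j) <= C0 exp (20 K eps0) p~_ij, hence of order
    C0 eps0 ([edge_log_ratio_bound]). So t is a little over 20 K eps0, a small
    number as eps0 <= 1 / (225 K^2), and |exp t - 1| <= |t| / (1 - |t|)
    ([normr_expR_sub1_le]) costs only a factor close to 1. *)

Lemma expR_le_inv1B {R : realType} (x : R) : x < 1 -> expR x <= (1 - x)^-1.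
Proof.
move=> x_lt1; have x1_gt0 : 0 < 1 - x by lra.
rewrite -[expR x]invrK -expRN lef_pV2 ?posrE ?expR_gt0 //.
exact: expR_ge1Dx.
Qed.

(** On the negative side [1 - expR t <= - t] already; the denominator pays for
    the positive side. *)
Lemma normr_expR_sub1_le {R : realType} (t s : R) :
  `|t| <= s -> s < 1 -> `|expR t - 1| <= s / (1 - s).
Proof.
move=> t_le s_lt1; have s1_gt0 : 0 < 1 - s by lra.
have s_ge0 : 0 <= s := le_trans (normr_ge0 t) t_le.
have s_le : s <= s / (1 - s) by rewrite ler_pdivlMr //; nra.
have sE : s / (1 - s) = (1 - s)^-1 - 1 by field; lra.
move: t_le; rewrite !ler_norml => /andP[t_ge t_le].
have := expR_ge1Dx t.
have : expR t <= (1 - s)^-1.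
  by rewrite (le_trans _ (expR_le_inv1B s s_lt1)) ?ler_expR.
by move=> exp_le exp_ge; apply/andP; split; lra.
Qed.

Lemma normr_coord_le {R : realType} {n : nat} (v : 'rV[R]_n) (i : 'I_n) :
  `|v 0 i| <= `|v|.
Proof.
rewrite [leRHS]/Num.norm /= mx_normrE.
by apply/bigmax_geP; right; exists (0, i).
Qed.

Lemma degree_ge0 {R : realType} {n : nat} (X : 'M[bool]_n) (i : 'I_n) :
  0 <= degree R X i.
Proof. by apply: sumr_ge0. Qed.

Lemma degree_le_total {R : realType} {n : nat} (X : 'M[bool]_n) (i : 'I_n) :
  degree R X i <= total_degree R X.
Proof.
rewrite /total_degree (bigD1 i) //= lerDl.
by apply: sumr_ge0 => j _; apply: degree_ge0.
Qed.

Lemma expR_alpha_tilde {R : realType} {n : nat} (X : 'M[bool]_n)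
  (i j : 'I_n) :
  0 < degree R X i -> 0 < degree R X j ->
  expR (alpha_tilde R X 0 i + alpha_tilde R X 0 j) = p_tilde R X i j.
Proof.
move=> di_gt0 dj_gt0.
have T_gt0 : 0 < total_degree R X := lt_le_trans di_gt0 (degree_le_total X i).
have sqrtT_gt0 : 0 < Num.sqrt (total_degree R X) by rewrite sqrtr_gt0.
rewrite /p_tilde !mxE !expRD !expRN !lnK ?posrE //.
by rewrite -[in RHS](sqr_sqrtr (ltW T_gt0)); field; rewrite gt_eqF.
Qed.

(** The mean inequality [2 d_i d_j <= d_i ^ 2 + d_j ^ 2] turns the control of
    each squared degree into a control of every mixed product. *)
Lemma p_tilde_le {R : realType} {n : nat} (X : 'M[bool]_n) (e : R)
  (i j : 'I_n) :
  0 < total_degree R X ->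
  degree R X i ^+ 2 <= e * total_degree R X ->
  degree R X j ^+ 2 <= e * total_degree R X ->
  p_tilde R X i j <= e.
Proof.
move=> T_gt0 hi hj; rewrite /p_tilde ler_pdivrMr //.
have := sqr_ge0 (degree R X i - degree R X j); nra.
Qed.

(** The constant 11/10 bounds [expR (4 / 45)], the growth of the sub-exponential
    envelope when both coordinates move by [10 (C0 + 1) e <= 2 / 45]. *)
Lemma edge_log_ratio_bound {R : realType} (C0 e x1 x2 a1 a2 f : R) :
  0 <= C0 -> (C0 + 1) * e <= 1 / 225 -> expR (a1 + a2) <= e ->
  `|x1 - a1| <= 10 * (C0 + 1) * e -> `|x2 - a2| <= 10 * (C0 + 1) * e ->
  `|f| <= C0 * expR (x1 + x2) ->
  `|(x1 - a1) + (x2 - a2) + f| <= (20 + 11 / 10) * ((C0 + 1) * e).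
Proof.
move=> C0_ge0 Ke_le a_le d1_le d2_le f_le.
have e_gt0 : 0 < e := lt_le_trans (expR_gt0 _) a_le.
have exp_le : expR (x1 + x2) <= 11 / 10 * e.
  have -> : x1 + x2 = ((x1 - a1) + (x2 - a2)) + (a1 + a2) by ring.
  rewrite expRD ler_pM ?expR_ge0 //.
  have small : (x1 - a1) + (x2 - a2) <= 4 / 45.
    have := ler_norm (x1 - a1); have := ler_norm (x2 - a2); lra.
  have small_lt1 : (4 / 45 : R) < 1 by lra.
  have inv_le : (1 - 4 / 45)^-1 <= 11 / 10 :> R.
    have -> : (1 - 4 / 45)^-1 = 45 / 41 :> R by field.
    lra.
  rewrite -ler_expR in small.
  exact: le_trans small (le_trans (expR_le_inv1B _ small_lt1) inv_le).
have {}f_le : `|f| <= 11 / 10 * ((C0 + 1) * e).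
  have := ler_wpM2l C0_ge0 exp_le; lra.
have := ler_normD ((x1 - a1) + (x2 - a2)) f.
have := ler_normD (x1 - a1) (x2 - a2); lra.
Qed.

Theorem corollary1 (R : realType) (n : nat) (hn : (2 <= n)%N)
  (X : 'M[bool]_n) (hX : adjacency X)
  (eps0 : R)
  (hdeg : forall i : 'I_n,
     1 <= degree R X i ^+ 2 /\ degree R X i ^+ 2 <= eps0 * total_degree R X)
  (C0 : R) (hC0 : 0 <= C0)
  (eps : eps_family R n)
  (heps : smooth_family eps) (hsub : sub_exponential C0 eps)
  (heps0 : eps0 <= (15 * (C0 + 1)) ^- 2)
  (alpha_hat : 'rV[R]_n)
  (hsol : likelihood_solution X eps alpha_hat)
  (hclose : `|alpha_hat - alpha_tilde R X| <= 10 * (C0 + 1) * eps0) :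
  forall i j : 'I_n, i != j ->
    `|(edge_prob eps i j alpha_hat - p_tilde R X i j) / p_tilde R X i j|
      <= 24 * (C0 + 1) * eps0.
Proof.
move=> i j ij.
have d_gt0 k : 0 < degree R X k.
  rewrite lt_neqAle degree_ge0 andbT eq_sym; apply/eqP => d0.
  by have [] := hdeg k; rewrite d0 expr0n /= ler10.
have T_gt0 : 0 < total_degree R X.
  exact: lt_le_trans (d_gt0 i) (degree_le_total X i).
have p_gt0 : 0 < p_tilde R X i j by rewrite /p_tilde divr_gt0 ?mulr_gt0.
have p_le : p_tilde R X i j <= eps0.
  by apply: p_tilde_le => //; [case: (hdeg i) | case: (hdeg j)].
have pE := expR_alpha_tilde X i j (d_gt0 i) (d_gt0 j).
have Ke_le : (C0 + 1) * eps0 <= 1 / 225.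
  have K_gt0 : 0 < (15 * (C0 + 1)) ^+ 2 by apply: exprn_gt0; lra.
  move: heps0; rewrite -[leRHS]div1r ler_pdivlMr // => h.
  have := lt_le_trans p_gt0 p_le; nra.
have close k : `|alpha_hat 0 k - alpha_tilde R X 0 k| <= 10 * (C0 + 1) * eps0.
  apply: le_trans hclose.
  have := normr_coord_le (alpha_hat - alpha_tilde R X) k.
  by rewrite [X in `|X|]mxE [X in _ + X]mxE.
have [f_le _ _ _] := hsub i j ij i i i alpha_hat.
have a_le : expR (alpha_tilde R X 0 i + alpha_tilde R X 0 j) <= eps0.
  by rewrite pE.
have t_le := edge_log_ratio_bound _ _ _ _ _ _ _ hC0 Ke_le a_le
  (close i) (close j) f_le.
have -> : (edge_prob eps i j alpha_hat - p_tilde R X i j) / p_tilde R X i j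
    = expR ((alpha_hat 0 i - alpha_tilde R X 0 i)
        + (alpha_hat 0 j - alpha_tilde R X 0 j) + eps_at eps i j alpha_hat) - 1.
  rewrite mulrBl divff ?gt_eqF // -pE -expRN -expRD; congr (expR _ - 1); ring.
have s_lt1 : (20 + 11 / 10) * ((C0 + 1) * eps0) < 1 by lra.
apply: le_trans (normr_expR_sub1_le _ _ t_le s_lt1) _.
rewrite ler_pdivrMr; last by lra.
have Ke_ge0 : 0 <= (C0 + 1) * eps0.
  apply: mulr_ge0; first by lra.
  exact: le_trans (ltW p_gt0) p_le.
(* With u = (C0 + 1) eps0 <= 1 / 225, the factor 24 (1 - 21.1 u) is still at
   least 21.1. *)
rewrite -[24 * _ * _]mulrA.
by move: Ke_le Ke_ge0 {s_lt1}; set u := (C0 + 1) * eps0; nra.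
Qed.
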